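(* Every graph $G$ on $n$ vertices admits a separating cycle system of size at most $41n$; that is, there is a family $\mathcal{S}$ with $|\mathcal{S}|\le 41n$, each member of which is a subgraph of $G$ that is either a single edge or a cycle, such that for every ordered pair $(e,f)$ of distinct edges of $G$ there is $S\in\mathcal{S}$ with $e\in E(S)$ and $f\notin E(S)$.
   Context: Graphs are finite and simple. A family $\mathcal{S}$ of subgraphs of $G$ separates an edge $e$ from an edge $f$ if some $S\in\mathcal{S}$ contains $e$ but not $f$. A separating cycle system of $G$ is a collection of edges and cycles of $G$ which, for every ordered pair $(e,f)$ of distinct edges of $G$, contains a member that separates $e$ from $f$. *)

(* Defs.v *)
From mathcomp Require Import all_boot.

Set Implicit Arguments.
Unset Strict Implicit.
Unset Printing Implicit Defensive.

(* A finite simple graph on the vertex set T is a symmetric irreflexive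
   relation e : rel T; its edges are the two-element sets [set x; y] with
   e x y.  A single edge or a cycle, as a subgraph, has no isolated vertex and
   is therefore represented by its edge set, of type {set {set T}}. *)

Section Graph.

Variable T : finType.
Implicit Types (e : rel T) (p : seq T) (a b : {set T}) (H : {set {set T}})
  (S : {set {set {set T}}}).

Definition edges e : {set {set T}} := [set [set x; y] | x in T, y in e x].

Definition is_edge e H : Prop := exists2 a, a \in edges e & H = [set a].

Definition cycle_edges p : {set {set T}} :=
  [set:: [seq [set x; next p x] | x <- p]].

(* ucycle e p alone also holds for [::] and for [:: x; y] with x, y adjacent,
   hence the condition on the length. *)
Definition is_cycle e H : Prop :=
  exists p, [/\ 2 < size p, ucycle e p & H = cycle_edges p].

Definition separates S a b : Prop :=
  exists2 H, H \in S & a \in H /\ b \notin H.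

Definition separating_cycle_system e S : Prop :=
  (forall H, H \in S -> is_edge e H \/ is_cycle e H) /\
  (forall a b, a \in edges e -> b \in edges e -> a != b -> separates S a b).

End Graph.

(* Main.v *)
Require Import Defs.
From mathcomp Require Import all_boot zify.

(* If every degree is at least 2, Posa rotations of a longest path give a
   nonempty set S of vertices such that W = S + N(S) has at most 3|S| elements
   and lies on a cycle C.  It suffices to deal with the edges at S and to delete
   S.  Number the m = |W| marks along C.  A family of chords (i, j) that is
   strictly increasing in both coordinates is covered by three cycles (two, if
   its chords cross pairwise) whose other edges lie on C: an odd number of
   pairwise crossing chords alternates with pieces of C in one path.  The lines
   j - i = l, and the lines j - 2 i = const relative to the m rotations of the
   marks, are such families, and two of these lines share one chord; thus at
   most 5m/2 + 3m cycles separate the chords from each other.  The same argument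
   covers any graph on m vertices by 15m/2 cycles and edges; applied to the edges
   at S outside C, this separates them from C and from the rest of the graph.
   The at most 2|S| edges of C at S are taken one by one, and
   5m/2 + 3m + 15m/2 + 2|S| <= 41|S|. *)

Set Implicit Arguments.
Unset Strict Implicit.
Unset Printing Implicit Defensive.

(** * Paths that follow the line of naturals and traverse given chords *)

Definition adj (T : eqType) (s : seq T) (x y : T) : Prop :=
  exists s1 s2, s = s1 ++ x :: y :: s2 \/ s = s1 ++ y :: x :: s2.

Definition lt2 (a b : nat * nat) : bool := (a.1 < b.1) && (a.2 < b.2).

(** Naturals stand for positions along a cycle cut open between its last and first vertex, and a
    chord is a pair of positions. The edge at the cut is left out; [good_cycle] restores it. *)
Definition step (X : seq (nat * nat)) (u v : nat) : bool :=
  [|| v == u.+1, u == v.+1, (u, v) \in X | (v, u) \in X].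

Lemma adj_catr (T : eqType) (s t : seq T) x y : adj s x y -> adj (s ++ t) x y.
Proof. by move=> [s1 [s2 [->|->]]]; exists s1, (s2 ++ t); rewrite -!catA; auto. Qed.

Lemma adj_catl (T : eqType) (s t : seq T) x y : adj t x y -> adj (s ++ t) x y.
Proof. by move=> [s1 [s2 [->|->]]]; exists (s ++ s1), s2; rewrite -!catA; auto. Qed.

Lemma adjC (T : eqType) (s : seq T) x y : adj s x y -> adj s y x.
Proof. by move=> [s1 [s2 h]]; exists s1, s2; tauto. Qed.

Lemma adj_join (T : eqType) (p q : seq T) x z w :
  adj (last x p :: q) z w -> adj (x :: p ++ q) z w.
Proof.
move=> h; rewrite -cat_cons lastI -cats1 -catA; exact: adj_catl.
Qed.

Lemma step_sub X Y : {subset X <= Y} -> subrel (step X) (step Y).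
Proof.
by move=> sXY u v /or4P[h|h|/sXY h|/sXY h]; rewrite /step h ?orbT.
Qed.

Lemma path_iota X x k : path (step X) x (iota x.+1 k).
Proof. by elim: k x => //= k IH x; rewrite /step eqxx IH. Qed.

Lemma last_iota x k : last x (iota x.+1 k) = x + k.
Proof. by elim: k x => [|k IH] x /=; rewrite ?addn0 // IH addSnnS. Qed.

Lemma lt2_trans : transitive lt2.
Proof. by move=> y x z /andP[h1 h2] /andP[h3 h4]; apply/andP; split; lia. Qed.

Lemma lt2_last x L : path lt2 x L -> x.2 <= (last x L).2.
Proof.
by elim: L x => //= y L IH x /andP[/andP[_ /ltnW xy] /IH]; apply: leq_trans.
Qed.

(** Such a path from the first to the last position of a cycle closes up, through the edge at the
    cut, to a cycle containing all chords of [X]. *)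
Definition through (lo hi : nat) (X : seq (nat * nat)) (q : seq nat) : Prop :=
  [/\ path (step X) lo q, last lo q = hi, uniq (lo :: q)
    & forall a, a \in X -> adj (lo :: q) a.1 a.2].

(* i1 -> j1 ~ j2 -> i2 ~ i3 -> j3 ~ ... : the chords alternate with pieces of
   the line, and ending at the last j needs an odd number of chords. *)
Lemma through_block M k i j L : size L = k.*2 -> sorted lt2 ((i, j) :: L) ->
  (forall a, a \in (i, j) :: L -> a.1 <= M < a.2) ->
  exists2 q, through i (last (i, j) L).2 ((i, j) :: L) q
    & {in i :: q, forall v,
        (i <= v <= M) || (j <= v <= (last (i, j) L).2)}.
Proof.
elim: k i j L => [|k IH] i j L.
  move=> /size0nil-> _ /(_ (i, j)); rewrite mem_head /= => /(_ isT) /andP[h1 h2].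
  exists [:: j].
    split=> //=; first by rewrite /step mem_head !orbT.
      rewrite inE andbT; lia.
    by move=> a; rewrite inE => /eqP->; exists [::], [::]; left.
  move=> v; rewrite !inE => /orP[] /eqP->; lia.
case: L => // -[i2 j2] [//|[i3 j3] L]; rewrite doubleS => -[szL].
move=> /= /and3P[/andP[/= i12 j12] /andP[/= i23 j23] sL] hM.
have [||q [pq lq uq aq] bq] := IH i3 j3 L szL.
- exact: sL.
- by move=> a aL; apply: hM; rewrite !inE -in_cons aL !orbT.
set J := (last _ _).2 in lq bq *.
have hjJ : j3 <= J by exact: lt2_last sL.
have [/andP[/= iM Mj] /andP[/= i2M _] /andP[/= i3M _]] :
  [/\ i <= M < j, i2 <= M < j2 & i3 <= M < j3].
  by split; [apply: (hM (i, j))|apply: (hM (i2, j2))|apply: (hM (i3, j3))];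
    rewrite !inE eqxx ?orbT.
(* [q1] climbs from [j] to [j2] on the right of [M], and [q2] from [i2] to [i3.-1] on the left; it
   stops one short because [i3] already heads the path given by induction. *)
pose q1 := j :: iota j.+1 (j2 - j).
pose q2 := i2 :: iota i2.+1 (i3 - i2.+1).
have l1 u : last u q1 = j2 by rewrite /= last_iota; lia.
have l2 u : last u q2 = i3.-1 by rewrite /= last_iota; lia.
have m1 v : (v \in q1) = (j <= v <= j2).
  rewrite inE mem_iota; lia.
have m2 v : (v \in q2) = (i2 <= v < i3).
  rewrite inE mem_iota; lia.
have u1 : uniq q1 by rewrite /q1 /= iota_uniq mem_iota; lia.
have u2 : uniq q2 by rewrite /q2 /= iota_uniq mem_iota; lia.
set X := (i, j) :: _.
exists (q1 ++ q2 ++ i3 :: q); first split.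
- rewrite cat_path l1 cat_path l2 /= {1}/step /X mem_head orbT orbT /=.
  rewrite !path_iota /= {1}/step !inE eqxx !orbT /=.
  rewrite {1}/step prednK ?eqxx /=; last lia.
  by apply: sub_path pq; apply: step_sub => a aL; rewrite !in_cons -in_cons aL !orbT.
- by rewrite !last_cat.
- rewrite cons_uniq !cat_uniq !mem_cat m1 m2 u1 u2 uq !andbT !andTb.
  have -> : (i \in i3 :: q) = false.
    apply/negP => /bq; lia.
  apply/and3P; split; first lia.
  + apply/hasPn => v; rewrite mem_cat m2 => hv; apply/negP => hv1.
    have : v \in q1 by exact: hv1.
    rewrite m1; case/orP: hv => [|/bq]; lia.
  + apply/hasPn => v /bq hv; apply/negP => hv2.
    have : v \in q2 by exact: hv2.
    rewrite m2; lia.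
- move=> a; rewrite /X in_cons => /orP[/eqP->|].
    by exists [::], (iota j.+1 (j2 - j) ++ q2 ++ i3 :: q); left.
  rewrite in_cons => /orP[/eqP->|aL].
    apply: (@adj_join _ q1); rewrite (l1 i).
    by apply: adjC; exists [::], (iota i2.+1 (i3 - i2.+1) ++ i3 :: q); left.
  have -> : i :: q1 ++ q2 ++ i3 :: q = (i :: q1 ++ q2) ++ i3 :: q.
    by rewrite /= -catA.
  exact/adj_catl/aq.
- move=> v; rewrite in_cons !mem_cat m1 m2 => /or4P[/eqP->||| /bq]; lia.
Qed.

(** The window from [lo] to [hi] is arbitrary so that such paths can be glued one after another. *)
Definition good (X : seq (nat * nat)) : Prop :=
  forall lo hi, lo <= hi -> (forall a, a \in X -> lo <= a.1 /\ a.2 <= hi) ->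
  exists2 q, through lo hi X q & {in lo :: q, forall v, lo <= v <= hi}.

Lemma good_nil : good [::].
Proof.
move=> lo hi lohi _; exists (iota lo.+1 (hi - lo)).
  split=> //; first exact: path_iota.
    by rewrite last_iota subnKC.
  rewrite /= iota_uniq mem_iota; lia.
move=> v; rewrite inE mem_iota; lia.
Qed.

Lemma through_cat lo mid hi X Y q r :
    through lo mid X q -> {in lo :: q, forall v, v <= mid} ->
    through mid hi Y r -> {in r, forall v, mid <= v} ->
  through lo hi (X ++ Y) (q ++ r).
Proof.
move=> [pq lq uq aq] hq [pr lr + ar] hr.
rewrite cons_uniq => /andP[mr ur]; split.
- rewrite cat_path lq; apply/andP; split.
    by apply: sub_path pq; apply: step_sub => a aX; rewrite mem_cat aX.
  by apply: sub_path pr; apply: step_sub => a aX; rewrite mem_cat aX orbT.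
- by rewrite last_cat lq.
- rewrite -cat_cons cat_uniq uq ur andbT; apply/hasPn => v vr.
  apply/negP => /hq vm; have := hr v vr.
  have : v != mid by apply: contraNneq mr => <-.
  lia.
- move=> a; rewrite mem_cat => /orP[/aq|/ar].
    by rewrite -cat_cons; apply: adj_catr.
  by rewrite -{1}lq; apply: adj_join.
Qed.

Lemma good_block M i j L X : ~~ odd (size L) -> sorted lt2 ((i, j) :: L) ->
    (forall a, a \in (i, j) :: L -> a.1 <= M < a.2) -> good X ->
    (forall a, a \in X -> (last (i, j) L).2 <= a.1) ->
  good (((i, j) :: L) ++ X).
Proof.
move=> oL sL hM gX hX lo hi lohi bd.
have iM := hM _ (mem_head _ _).
have [|lo_i _] := bd (i, j); first by rewrite mem_head.
rewrite /= in iM lo_i.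
have lL : last (i, j) L \in (i, j) :: L by rewrite mem_last.
have [|_ J_hi] := bd (last (i, j) L); first by rewrite mem_cat lL.
have lM := hM _ lL.
have [k szL] : exists k, size L = k.*2 by exists (size L)./2; rewrite even_halfK.
have [q1 t1 b1] := @good_nil lo i lo_i (fun a => ltac:(by [])).
have [q2 t2 b2] := through_block szL sL hM.
have [|q3 t3 b3] := gX (last (i, j) L).2 hi J_hi.
  by move=> a aX; split; [exact: hX | have [] := bd a; rewrite // mem_cat aX orbT].
have jJ : j <= (last (i, j) L).2.
  exact: lt2_last sL.
set J := (last _ _).2 in t2 b2 t3 b3 J_hi lM jJ hX.
have h2 : {in i :: q2, forall v, i <= v <= J}.
  by move=> v /b2; lia.
have t12 : through lo J ((i, j) :: L) (q1 ++ q2).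
  rewrite -[_ :: L]/([::] ++ _); apply: through_cat t1 _ t2 _.
    by move=> v /b1; lia.
  by move=> v vq; have := h2 v; rewrite inE vq orbT => /(_ isT); lia.
have h12 : {in lo :: q1 ++ q2, forall v, lo <= v <= J}.
  move=> v; rewrite -cat_cons mem_cat => /orP[/b1|vq]; first by lia.
  by have := h2 v; rewrite inE vq orbT => /(_ isT); lia.
exists ((q1 ++ q2) ++ q3).
  apply: through_cat t12 _ t3 _; first by move=> v /h12; lia.
  by move=> v vq; have := b3 v; rewrite inE vq orbT => /(_ isT); lia.
move=> v; rewrite -cat_cons mem_cat => /orP[/h12|vq]; first lia.
by have := b3 v; rewrite inE vq orbT => /(_ isT); lia.
Qed.

(* Greedy odd blocks of pairwise crossing chords, coloured cyclically with
   three colours: parity may push one chord of a crossing run to the next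
   block, and then two blocks apart is not far enough, but three is. *)
Lemma three_good L : sorted lt2 L -> (forall a, a \in L -> a.1 < a.2) ->
  exists X0 X1 X2, [/\ good X0 /\ {subset X0 <= L},
    [/\ good X1, {subset X1 <= L} & forall a, a \in X1 -> (head a L).1 < a.1],
    [/\ good X2, {subset X2 <= L} & forall a, a \in X2 -> (head a L).2 <= a.1]
    & forall a, a \in L -> a \in X0 \/ a \in X1 \/ a \in X2].
Proof.
have [n] := ubnP (size L); elim: n L => // n IH [|[i j] L] szL sL ltL.
  by exists [::], [::], [::]; split=> //; split=> //; apply: good_nil.
have minL := order_path_min lt2_trans sL.
have ij : i < j by apply: (ltL (i, j)); rewrite mem_head.
(* [k] counts the chords of [L] that cross [(i, j)]. Rounding it down to the even [h] makes the
   block [(i, j) :: take h L] odd and leaves at most one crossing chord, the head of [drop h L]. *)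
pose k := find (fun a => j <= a.1) L.
pose h := k./2.*2.
have hk : h <= k <= h.+1 by rewrite /h; lia.
have kL : k <= size L by rewrite find_size.
have szB : size (take h L) = h by rewrite size_takel //; lia.
have crossB a : a \in take h L -> a.1 < j.
  move=> aB; rewrite -(nth_index a aB).
  have ih : index a (take h L) < h by rewrite -[X in _ < X]szB index_mem.
  rewrite nth_take //; rewrite ltnNge; apply/negbT.
  apply: (before_find a (a := fun a => j <= a.1)); rewrite -/k; lia.
have sL' : sorted lt2 (drop h L).
  by apply: drop_sorted; apply: path_sorted sL.
have subL' : {subset drop h L <= L} by move=> a; apply: mem_drop.
have farL' a : a \in behead (drop h L) -> j <= a.1.
  rewrite -drop1 drop_drop => aD.
  have kn : k < size L.
    have : 0 < size (drop (1 + h) L) by case: (drop _ _) aD.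
    rewrite size_drop; lia.
  have nk : j <= (nth a L k).1.
    by apply: (nth_find a (a := fun a => j <= a.1)); rewrite has_find.
  have : a \in drop k L.
    have -> : drop k L = take (1 + h - k) (drop k L) ++ drop (1 + h) L.
      rewrite -[LHS](cat_take_drop (1 + h - k)) drop_drop; congr (_ ++ drop _ _).
      lia.
    by rewrite mem_cat aD orbT.
  rewrite (drop_nth a kn) inE => /orP[/eqP->//|aD'].
  have : sorted lt2 (drop k L).
    by apply: drop_sorted; apply: path_sorted sL.
  rewrite (drop_nth a kn) /= => /(order_path_min lt2_trans)/allP/(_ _ aD').
  by move=> /andP[h1 _]; apply: leq_trans nk (ltnW h1).
have [||X0 [X1 [X2 [[g0 s0] [g1 s1 l1] [g2 s2 l2] cov]]]] := IH (drop h L) _ sL'.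
- by rewrite size_drop; move: szL => /=; lia.
- by move=> a aL; apply: ltL; rewrite inE subL' ?orbT.
have B_lt a : a \in drop h L -> (last (i, j) (take h L)).2 < a.2.
  move=> aD; have := sL; rewrite -[L in sorted _ (_ :: L)](cat_take_drop h) /=.
  rewrite cat_path => /andP[_ p2].
  by have /allP/(_ _ aD)/andP[] := order_path_min lt2_trans p2.
(* The colours rotate. The chords of [X2] start no earlier than the right end of the first chord of
   [drop h L], hence beyond the new block, which may be put in front of them. [X1] misses that first
   chord, the only remaining one that can cross [(i, j)], so it qualifies as the new third class. *)
exists (((i, j) :: take h L) ++ X2), X0, X1; split.
- split; last first.
    move=> a; rewrite mem_cat !inE => /orP[/orP[->//|/mem_take->]|/s2/subL'->];
      by rewrite orbT.
  (* Every chord of the block starts at [j.-1] or earlier and ends at [j] or later. *)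
  apply: (@good_block j.-1) => //.
  + by rewrite szB /h odd_double.
  + by have := sL; rewrite -[L in sorted _ (_ :: L)](cat_take_drop h) /= cat_path
      => /andP[].
  + move=> a; rewrite inE => /orP[/eqP->/=|aB]; first lia.
    have /andP[/= _ ja] := allP minL _ (mem_take aB).
    have j_gt0 : 0 < j := leq_ltn_trans (leq0n i) ij.
    rewrite -ltnS prednK // (crossB _ aB) /=.
    exact: ltnW ja.
  + move=> a aX; have := l2 a aX; have := s2 a aX.
    case: (drop h L) B_lt => // b D B_lt _ /=.
    exact: leq_trans (ltnW (B_lt b (mem_head _ _))).
- split=> //; first by move=> a /s0 /subL' aL; rewrite inE aL orbT.
  by move=> a /s0 /subL' /(allP minL) /andP[].
- split=> //; first by move=> a /s1 /subL' aL; rewrite inE aL orbT.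
  move=> a aX /=; apply: farL'; have := l1 a aX; have := s1 a aX.
  by case: (drop h L) => // b D; rewrite inE => /orP[/eqP->|//]; rewrite /= ltnn.
- move=> a; rewrite inE mem_cat inE => /orP[->|]; first by left.
  rewrite -{1}(cat_take_drop h L) mem_cat => /orP[->|/cov]; first by rewrite orbT; left.
  by move=> [->|[->|->]]; rewrite ?orbT; auto.
Qed.

(** * From paths on the line to cycles of the graph *)

Section CycleEdges.
Variable T : finType.
Implicit Types (e : rel T) (c p : seq T) (x y : T).

Lemma next_nthS x0 c i : uniq c -> i.+1 < size c ->
  next c (nth x0 c i) = nth x0 c i.+1.
Proof.
case: c => // y p Uc ip; rewrite next_nth mem_nth ?(ltnW ip) //.
by rewrite index_uniq ?(ltnW ip) //= (set_nth_default x0).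
Qed.

Lemma next_nth_last x0 c : uniq c -> 0 < size c ->
  next c (nth x0 c (size c).-1) = nth x0 c 0.
Proof.
case: c => // y p Uc _; rewrite next_nth mem_nth //.
by rewrite index_uniq // nth_default.
Qed.

Lemma mem_cycle_edges c x : x \in c -> [set x; next c x] \in cycle_edges c.
Proof. by move=> xc; rewrite inE; apply/mapP; exists x. Qed.

Lemma cycle_edgesP e c z : cycle e c -> z \in cycle_edges c ->
  exists x y, [/\ x \in c, y \in c, e x y & z = [set x; y]].
Proof.
move=> Cc; rewrite inE => /mapP[x xc ->]; exists x, (next c x).
by split; rewrite ?mem_next //; apply: next_cycle.
Qed.

Lemma cycle_edges_rot n c : uniq c -> cycle_edges (rot n c) = cycle_edges c.
Proof.
move=> Uc; apply/setP => z; rewrite !inE.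
by apply/mapP/mapP => -[x xc ->]; exists x;
  rewrite ?next_rot // ?mem_rot // in xc *.
Qed.

Lemma adj_cycle_edges c x y : uniq c -> adj c x y -> [set x; y] \in cycle_edges c.
Proof.
have main x' y' s1 s2 : uniq (s1 ++ x' :: y' :: s2) ->
    [set x'; y'] \in cycle_edges (s1 ++ x' :: y' :: s2).
  move=> Uc; rewrite -(cycle_edges_rot (size s1)) // rot_size_cat /=.
  by have /= := mem_cycle_edges (mem_head x' (y' :: s2 ++ s1)); rewrite eqxx.
by move=> Uc [s1 [s2 [h|h]]]; rewrite h in Uc *; [|rewrite setUC]; apply: main.
Qed.

Lemma adj_map (f : nat -> T) s i j : adj s i j -> adj (map f s) (f i) (f j).
Proof.
by move=> [s1 [s2 [->|->]]]; exists (map f s1), (map f s2); rewrite map_cat /=; auto.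
Qed.

(** The path from position [0] to the last position closes with the edge of [c] joining these two;
    its other edges are edges of [c] or chords of [X]. *)
Lemma good_cycle e x0 c X : symmetric e -> ucycle e c -> 2 < size c -> good X ->
    (forall a, a \in X -> [/\ a.1 < a.2 < size c,
       e (nth x0 c a.1) (nth x0 c a.2)
       & [set nth x0 c a.1; nth x0 c a.2] \notin cycle_edges c]) ->
  exists D, [/\ is_cycle e D,
    forall z, z \in D -> z \in cycle_edges c \/
      exists2 a, a \in X & z = [set nth x0 c a.1; nth x0 c a.2]
    & forall a, a \in X -> [set nth x0 c a.1; nth x0 c a.2] \in D].
Proof.
move=> e_sym /andP[Cc Uc] szc gX hX.
have [||q [pq lq uq aq] bq] := gX 0 (size c).-1 => //.
  by move=> a /hX[+ _ _]; lia.
pose f := nth x0 c; pose D := map f (0 :: q).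
pose A := cycle_edges c :|:
  [set:: [seq [set nth x0 c a.1; nth x0 c a.2] | a <- X]].
pose r u v := e u v && ([set u; v] \in A).
have r_sym : symmetric r by move=> u v; rewrite /r e_sym setUC.
have eS i : i.+1 < size c -> r (f i) (f i.+1).
  move=> ic; rewrite /r /f -next_nthS // next_cycle ?mem_nth ?(ltnW ic) //.
  by rewrite inE mem_cycle_edges ?mem_nth ?(ltnW ic).
have e0 : r (f (size c).-1) (f 0).
  have lc : (size c).-1 < size c by lia.
  rewrite /r /f -next_nth_last ?next_cycle ?mem_nth //; last lia.
  by rewrite inE mem_cycle_edges ?mem_nth.
have eX a : a \in X -> r (f a.1) (f a.2).
  move=> aX; have [_ h _] := hX a aX.
  by rewrite /r h !inE; apply/orP; right; apply/mapP; exists a.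
have CD : cycle r D.
  rewrite -[cycle r D]/(path r (f 0) (rcons (map f q) (f 0))).
  rewrite rcons_path last_map lq e0 andbT path_map.
  apply: (sub_in_path (P := [pred v | v < size c])) pq.
    move=> u v uc vc /or4P[/eqP vE|/eqP uE|/eX //|/eX]; last by rewrite r_sym.
      by move: vc; rewrite vE; apply: eS.
    by move: uc; rewrite uE /relpre /= r_sym; apply: eS.
  by apply/allP => v /bq /=; lia.
have UD : uniq D.
  rewrite map_inj_in_uniq // => u v /bq hu /bq hv /eqP.
  have [uc vc] : u < size c /\ v < size c by lia.
  by rewrite nth_uniq // => /eqP.
(* A path on at most two vertices would be a single step from [0] to the last position. As [c] has
   at least three vertices, this step is a chord, yet it is also the closing edge of [c], which [hX]
   excludes. *)
have szD : 2 < size D.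
  rewrite size_map; case: (q) pq lq aq bq => [|v [|//]] /=; first lia.
  rewrite andbT => h lv _ _; move: h; rewrite lv => /or4P[/eqP|/eqP|h|h]; try lia.
    have [_ _ /negP[]] := hX _ h; rewrite setUC -(next_nth_last x0) //; last lia.
    by rewrite mem_cycle_edges // mem_nth //=; lia.
  by have [/= + _ _] := hX _ h; lia.
exists (cycle_edges D); split.
- exists D; split=> //; rewrite /ucycle UD andbT.
  by apply: sub_cycle CD => u v /andP[].
- move=> z; rewrite inE => /mapP[x xD ->].
  have /andP[_] := next_cycle CD xD.
  rewrite inE => /orP[|]; first by left.
  by rewrite inE => /mapP[a aX ->]; right; exists a.
- by move=> a /aq aa; apply: adj_cycle_edges => //; apply: (adj_map f).
Qed.

End CycleEdges.

(** * Covering an increasing family of chords by two or three cycles *)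

Section Lines.
Variables (T : finType) (e : rel T).
Hypothesis e_sym : symmetric e.
Implicit Types (c : seq T) (W : {set T}) (K : seq (nat * nat)).

Definition chord c (u v : T) : bool := e u v && ([set u; v] \notin cycle_edges c).

Definition line (x0 : T) (w : seq T) K : {set {set T}} :=
  [set:: [seq [set nth x0 w a.1; nth x0 w a.2] | a <- K]].

Lemma ltn_index_filter x0 (P : pred T) c k l : uniq c ->
    k < l < size (filter P c) ->
  index (nth x0 (filter P c) k) c < index (nth x0 (filter P c) l) c.
Proof.
move=> Uc /andP[kl ls].
have tr : transitive (relpre (index^~ c) ltn).
  by move=> y x z; apply: ltn_trans.
apply: (sorted_ltn_nth tr x0 (s := filter P c)); rewrite ?inE ?(ltn_trans kl ls) //.
apply: sorted_filter => //; apply/(sortedP x0) => i ic /=.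
by rewrite !index_uniq // (ltnW ic).
Qed.

(** [K] consists of pairs of indices of marks, the vertices of [c] satisfying [P]. Passing from a
    mark to its position on [c] is increasing, so the pairs that are chords of the graph can be
    handed to [three_good]. The flag [b] announces a pairwise crossing family. *)
Lemma line_cover (b : bool) x0 c (P : pred T) K : ucycle e c -> 2 < size c ->
    sorted lt2 K ->
    (forall a, a \in K -> a.1 < a.2 < size (filter P c)) ->
    (b -> forall a a', a \in K -> a' \in K -> a.1 < a'.2) ->
  exists F : {set {set {set T}}}, [/\ #|F| <= 2 + ~~ b,
    forall D, D \in F ->
      is_cycle e D /\ D \subset cycle_edges c :|: line x0 (filter P c) K
    & forall a, a \in K ->
        chord c (nth x0 (filter P c) a.1) (nth x0 (filter P c) a.2) ->
        exists2 D, D \in F &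
          [set nth x0 (filter P c) a.1; nth x0 (filter P c) a.2] \in D].
Proof.
move=> Cc szc sK bK crK; have /andP[_ Uc] := Cc.
pose w := filter P c; pose pos k := index (nth x0 w k) c.
pose K' := [seq a <- K | chord c (nth x0 w a.1) (nth x0 w a.2)].
pose L := [seq (pos a.1, pos a.2) | a <- K'].
have w_c k : k < size w -> nth x0 w k \in c.
  by move=> kw; have := mem_nth x0 kw; rewrite mem_filter => /andP[].
have posK k : k < size w -> nth x0 c (pos k) = nth x0 w k.
  by move=> kw; rewrite nth_index ?w_c.
have pos_lt k : k < size w -> pos k < size c by move=> kw; rewrite index_mem w_c.
have pos_mono k l : k < l < size w -> pos k < pos l by apply: ltn_index_filter.
have bK1 a : a \in K -> a.1 < size w by move/bK => /andP[/ltn_trans]; apply.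
have bK2 a : a \in K -> a.2 < size w by move/bK => /andP[].
have LP x : x \in L -> exists a, [/\ a \in K, x = (pos a.1, pos a.2)
    & chord c (nth x0 w a.1) (nth x0 w a.2)].
  by move=> /mapP[a]; rewrite mem_filter => /andP[ha aK] ->; exists a.
have sL : sorted lt2 L.
  rewrite /L sorted_map; have : sorted lt2 K' by apply: sorted_filter lt2_trans _ _ sK.
  apply: (sub_in_sorted (P := [in K])); last first.
    by apply/allP => a; rewrite mem_filter => /andP[].
  move=> a a' aK a'K /andP[h1 h2]; apply/andP; split.
    by apply: pos_mono; rewrite h1 bK1.
  by apply: pos_mono; rewrite h2 bK2.
have ltL x : x \in L -> x.1 < x.2.
  by move=> /LP[a [aK -> _]]; apply/pos_mono/bK.
have [X0 [X1 [X2 [[g0 s0] [g1 s1 _] [g2 s2 l2] cov]]]] := three_good sL ltL.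
have mk X : good X -> {subset X <= L} -> exists D, [/\ is_cycle e D,
    D \subset cycle_edges c :|: line x0 w K
    & forall a, a \in K -> (pos a.1, pos a.2) \in X ->
        [set nth x0 w a.1; nth x0 w a.2] \in D].
  move=> gX sX; have [|D [cD subD XD]] := good_cycle (x0 := x0) e_sym Cc szc gX.
    move=> x xX; have xL := sX x xX; have [a [aK xE /andP[ea na]]] := LP x xL.
    by rewrite ltL // xE /= !posK ?bK1 ?bK2 // pos_lt ?bK2.
  exists D; split=> //.
    apply/subsetP => z /subD[zC|[x xX ->]]; first by rewrite inE zC.
    have [a [aK -> _]] := LP x (sX x xX); rewrite /= !posK ?bK1 ?bK2 //.
    by rewrite !inE; apply/orP; right; apply/mapP; exists a.
  by move=> a aK /XD /=; rewrite !posK ?bK1 ?bK2.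
have [D0 [c0 sub0 cov0]] := mk _ g0 s0.
have [D1 [c1 sub1 cov1]] := mk _ g1 s1.
have [D2 [c2 sub2 cov2]] := mk _ g2 s2.
have KL a : a \in K -> chord c (nth x0 w a.1) (nth x0 w a.2) ->
    (pos a.1, pos a.2) \in L.
  by move=> aK ha; apply/mapP; exists a => //; rewrite mem_filter ha.
case: b crK => crK; last first.
  exists [set D0; D1; D2]; split.
  - by rewrite !cardsU !cards1; lia.
  - by move=> D; rewrite !inE => /orP[/orP[]|] /eqP->.
  - move=> a aK ha; have [/cov0 h|[/cov1 h|/cov2 h]] := cov _ (KL a aK ha);
    [exists D0|exists D1|exists D2]; by rewrite ?h // !inE eqxx ?orbT.
exists [set D0; D1]; split.
- by rewrite !cardsU !cards1; lia.
- by move=> D; rewrite !inE => /orP[] /eqP->.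
- move=> a aK ha; have [/cov0 h|[/cov1 h|x2]] := cov _ (KL a aK ha).
  + by exists D0; rewrite ?h // !inE eqxx.
  + by exists D1; rewrite ?h // !inE eqxx orbT.
  (* Pairwise crossing empties the third class, whose chords start at or after the right end of the
     first chord. *)
  + have aL := s2 _ x2; have := l2 _ x2.
    have : head (pos a.1, pos a.2) L \in L by case: (L) aL => // y L'; rewrite mem_head.
    move=> /LP[a' [a'K -> _]] /=.
    by rewrite leqNgt pos_mono // crK // bK2.
Qed.

End Lines.

(** * Arithmetic of the rotated lines [j = 2 * i + 1] *)

Definition shift (m r i : nat) : nat := if i + r < m then i + r else i + r - m.

Lemma ltn_shift m r i : r < m -> i < m -> shift m r i < m.
Proof. by rewrite /shift; case: ifP => ?; lia. Qed.

(** The marks [k] and [k.*2.+1] are [k.+1] apart on the circle. So [k] is [l.-1] if [l] is at most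
    half of [m]; otherwise the pair is read the other way round, at distance [m - l], and [k] is
    [(m - l).-1]. This determines the rotation [r] modulo [m]. *)
Lemma on_rotated_line m p l : 0 < l -> p + l < m ->
  exists r k, [/\ r < m, k < m./2 &
    (shift m r k = p /\ shift m r k.*2.+1 = p + l) \/
    (shift m r k = p + l /\ shift m r k.*2.+1 = p)].
Proof.
move=> l0 pl; have [lm|lm] := leqP l.*2 m.
  exists (if l <= p.+1 then p.+1 - l else p.+1 + m - l), l.-1.
  split; [case: ifP => ?; lia | lia | left; rewrite /shift].
  by case: (leqP l p.+1) => ?; split; case: ifP => ?; lia.
exists (if p + l + l.+1 < m then p + l + l.+1 else p + l + l.+1 - m), (m - l).-1.
split; [case: ifP => ?; lia | lia | right; rewrite /shift].
by case: (ltnP (p + l + l.+1) m) => ?; split; case: ifP => ?; lia.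
Qed.

(** Both [k.+1] and [k'.+1] are at most half of [m] and congruent to [l] or [-l] modulo [m], so both
    equal the circular distance of the pair. *)
Lemma rotated_line_inj m r l k k' p p' : k < m./2 -> k' < m./2 -> r < m ->
    (shift m r k = p /\ shift m r k.*2.+1 = p + l) \/
    (shift m r k = p + l /\ shift m r k.*2.+1 = p) ->
    (shift m r k' = p' /\ shift m r k'.*2.+1 = p' + l) \/
    (shift m r k' = p' + l /\ shift m r k'.*2.+1 = p') ->
  k' = k.
Proof.
rewrite /shift => km km' rm.
by do 2![case: ifP => ?] => h; do 2![case: ifP => ?] => h'; lia.
Qed.

(** * Separating the chords between marks *)

Section Families.
Variables (T : finType) (e : rel T).
Hypotheses (e_sym : symmetric e) (e_irr : irreflexive e).
Implicit Types (c : seq T) (W : {set T}).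

Lemma set2_eq (x y u v : T) : [set x; y] = [set u; v] ->
  (x = u /\ y = v) \/ (x = v /\ y = u).
Proof.
move=> h; move: (set21 x y) (set22 x y) (set21 u v) (set22 u v).
rewrite h -{3 4}h !inE.
by do 4![case/orP=> /eqP ?]; subst; auto.
Qed.

Lemma card_bigcup_leq (I U : finType) (F : I -> {set U}) (f : I -> nat) :
  (forall i, #|F i| <= f i) -> #|\bigcup_i F i| <= \sum_i f i.
Proof.
move=> Ff; elim/big_rec2: _ => [|i n A _ An]; first by rewrite cards0.
by rewrite cardsU (leq_trans (leq_subr _ _)) ?leq_add.
Qed.

Lemma sum_ltn_min n h : \sum_(i < n) (i < h) = minn n h.
Proof.
elim: n => [|n IH]; first by rewrite big_ord0 min0n.
rewrite big_ord_recr /= IH; lia.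
Qed.

Lemma nth_rot_small (x0 : T) r k s : r < size s -> k < size s ->
  nth x0 (rot r s) k = nth x0 s (shift (size s) r k).
Proof.
rewrite /shift => rs ks; rewrite /rot nth_cat size_drop nth_drop.
have -> : (k < size s - r) = (k + r < size s) by lia.
case: ifP => h; first by rewrite addnC.
rewrite nth_take; [congr (nth _ _ _); lia | lia].
Qed.

(** Restarting [c] at its mark number [r] rotates the marks by [r]; this lets [line_cover] serve the
    rotated lines too. *)
Lemma filter_rot (x0 : T) (P : pred T) c r : uniq c -> r < size (filter P c) ->
  filter P (rot (index (nth x0 (filter P c) r) c) c) = rot r (filter P c).
Proof.
move=> Uc rw; set v := nth _ _ r; set n := index v c.
have vw : v \in filter P c by rewrite mem_nth.
have [Pv vc] : P v /\ v \in c by move: vw; rewrite mem_filter => /andP.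
have E : filter P c = filter P (take n c) ++ filter P (drop n c).
  by rewrite -filter_cat cat_take_drop.
have szr : size (filter P (take n c)) = r.
  have := index_uniq x0 rw (filter_uniq _ Uc); rewrite -/v {1}E index_cat.
  have -> : (v \in filter P (take n c)) = false.
    rewrite mem_filter Pv /= in_take //.
    by rewrite ltnn.
  have -> : drop n c = v :: drop n.+1 c.
    by rewrite (drop_nth x0) ?index_mem // nth_index.
  by rewrite /= Pv /= eqxx addn0.
by rewrite /rot filter_cat E; congr (_ ++ _);
  rewrite -[in RHS]szr ?drop_size_cat ?take_size_cat.
Qed.

(* A chord lies on a line [j - i = l] of marks (family [FA]) and, for a suitable
   rotation of the marks, on the line [j = 2 * i + 1] (family [FB]); [l] and the
   rotation determine the chord. *)
Lemma chord_families c W : ucycle e c -> 2 < size c -> {subset W <= c} ->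
  exists FA FB : {set {set {set T}}},
  [/\ 2 * #|FA| <= 5 * #|W|.-1 /\ #|FB| <= 3 * #|W|,
      forall D, D \in FA :|: FB -> is_cycle e D,
      forall u v, u \in W -> v \in W -> chord e c u v ->
        exists2 D, D \in FA & [set u; v] \in D
    & forall u v u' v', u \in W -> v \in W -> u' \in W -> v' \in W ->
        chord e c u v -> chord e c u' v' -> [set u; v] != [set u'; v'] ->
        exists2 D, D \in FA :|: FB & [set u; v] \in D /\ [set u'; v'] \notin D].
Proof.
move=> Cc szc Wc; have /andP[_ Uc] := Cc.
have x0 : T by move: szc; case: (c).
pose P := mem W; pose w := filter P c; pose m := #|W|.
have Uw : uniq w by rewrite filter_uniq.
have wE : w =i W.
  by move=> v; rewrite mem_filter; apply: andb_idr => /Wc.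
have szw : size w = m by rewrite /m -(card_uniqP Uw); apply: eq_card => v; rewrite wE.
pose KA l := [seq (k, k + l) | k <- iota 0 (m - l)].
pose KB := [seq (k, k.*2.+1) | k <- iota 0 m./2].
have KAP l a : a \in KA l -> [/\ a.1 < m - l & a.2 = a.1 + l].
  by move=> /mapP[k]; rewrite mem_iota => kl ->.
have KBP a : a \in KB -> [/\ a.1 < m./2 & a.2 = a.1.*2.+1].
  by move=> /mapP[k]; rewrite mem_iota => kl ->.
(* The index [l] stands for the difference [l.+1]. Once twice the difference reaches [m], every left
   end is below every right end, so the chords cross pairwise. *)
have famA (l : 'I_m.-1) : exists F : {set {set {set T}}},
  [/\ #|F| <= 2 + ~~ (m <= l.+1.*2),
    forall D, D \in F -> is_cycle e D /\ D \subset cycle_edges c :|: line x0 w (KA l.+1)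
    & forall a, a \in KA l.+1 -> chord e c (nth x0 w a.1) (nth x0 w a.2) ->
        exists2 D, D \in F & [set nth x0 w a.1; nth x0 w a.2] \in D].
  apply: line_cover => //.
  - rewrite sorted_map; apply: sub_sorted (iota_ltn_sorted _ _) => i j ij.
    by apply/andP; split=> /=; lia.
  - by move=> a /KAP[h1 ->]; rewrite -/w szw; lia.
  - by move=> ml a a' /KAP[h1 _] /KAP[h2 ->]; lia.
have famB (r : 'I_m) : exists F : {set {set {set T}}},
  [/\ #|F| <= 3,
    forall D, D \in F -> is_cycle e D /\
      D \subset cycle_edges c :|: line x0 (rot r w) KB
    & forall a, a \in KB -> chord e c (nth x0 (rot r w) a.1) (nth x0 (rot r w) a.2) ->
        exists2 D, D \in F & [set nth x0 (rot r w) a.1; nth x0 (rot r w) a.2] \in D].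
  have rw : r < size w by rewrite szw.
  have := @line_cover T e e_sym false x0 (rot (index (nth x0 w r) c) c) P KB.
  rewrite /chord cycle_edges_rot // (filter_rot _ Uc rw); apply.
  - by rewrite /ucycle rot_uniq rot_cycle.
  - by rewrite size_rot.
  - rewrite sorted_map; apply: sub_sorted (iota_ltn_sorted _ _) => i j ij.
    by apply/andP; split=> /=; lia.
  - by move=> a /KBP[h1 ->]; rewrite size_rot szw; lia.
  - by [].
have [FA hA] := fin_all_exists famA.
have [FB hB] := fin_all_exists famB.
have mark v : v \in W -> exists2 p, p < m & v = nth x0 w p.
  move=> vW; exists (index v w); first by rewrite -szw index_mem wE.
  by rewrite nth_index // wE.
have nthI p q : p < m -> q < m -> nth x0 w p = nth x0 w q -> p = q.
  by move=> pm qm /eqP; rewrite (nth_uniq x0) ?szw // => /eqP.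
have pairI p q p' q' : p < m -> q < m -> p' < m -> q' < m ->
    [set nth x0 w p; nth x0 w q] = [set nth x0 w p'; nth x0 w q'] ->
    (p = p' /\ q = q') \/ (p = q' /\ q = p').
  move=> pm qm pm' qm' /set2_eq[] [h1 h2]; [left|right].
    by split; apply: nthI.
  by split; apply: nthI.
have ordered u v : u \in W -> v \in W -> chord e c u v -> exists p l,
    [/\ 0 < l, p + l < m, [set u; v] = [set nth x0 w p; nth x0 w (p + l)]
      & chord e c (nth x0 w p) (nth x0 w (p + l))].
  move=> /mark[p pm ->] /mark[q qm ->] ch.
  case: (ltngtP p q) => [pq|qp|pqE].
  - by exists p, (q - p); rewrite (subnKC (ltnW pq)); split; [rewrite subn_gt0 | | | ].
  - exists q, (p - q); rewrite (subnKC (ltnW qp)).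
    split; [by rewrite subn_gt0 | exact: pm | exact: setUC |].
    by rewrite /chord e_sym setUC.
  - by move: ch; rewrite /chord pqE e_irr.
have inA u v p l : 0 < l -> p + l < m ->
    [set u; v] = [set nth x0 w p; nth x0 w (p + l)] ->
    chord e c (nth x0 w p) (nth x0 w (p + l)) ->
    exists2 D, D \in \bigcup_i FA i &
      [set u; v] \in D /\ D \subset cycle_edges c :|: line x0 w (KA l).
  move=> l0 pl -> ch; have lm : l.-1 < m.-1 by lia.
  have [_ subD covD] := hA (Ordinal lm); rewrite /= prednK // in subD covD.
  have [||D DF hD] := covD (p, p + l); rewrite //=.
    by apply/mapP; exists p; rewrite // mem_iota; lia.
  exists D; first by apply/bigcupP; exists (Ordinal lm).
  by split=> //; have [] := subD D DF.
have subA D : D \in \bigcup_i FA i -> is_cycle e D.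
  by move=> /bigcupP[i _ Di]; have [_ /(_ D Di)[]] := hA i.
have subB D : D \in \bigcup_i FB i -> is_cycle e D.
  by move=> /bigcupP[i _ Di]; have [_ /(_ D Di)[]] := hB i.
exists (\bigcup_i FA i), (\bigcup_i FB i); split.
- split; last first.
    apply: leq_trans (card_bigcup_leq (f := fun=> 3) _) _.
      by move=> i; have [] := hB i.
    by rewrite sum_nat_const card_ord mulnC.
  (* Each of the [m.-1] differences costs two cycles, and the [m.-1./2] differences below half of
     [m] cost a third. *)
  apply: leq_trans (_ : 2 * \sum_(i < m.-1) (2 + ~~ (m <= i.+1.*2)) <= _).
    by rewrite leq_mul2l /=; apply: card_bigcup_leq => i; have [] := hA i.
  rewrite big_split /= sum_nat_const card_ord.
  have -> : \sum_(i < m.-1) ~~ (m <= i.+1.*2) = \sum_(i < m.-1) (i < m.-1./2).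
    by apply: eq_bigr => i _; congr (nat_of_bool _); have := ltn_ord i; lia.
  rewrite sum_ltn_min; clear; lia.
- by move=> D; rewrite inE => /orP[/subA|/subB].
- move=> u v uW vW ch; have [p [l [l0 pl uvE ch']]] := ordered u v uW vW ch.
  by have [D DF [hD _]] := inA u v p l l0 pl uvE ch'; exists D.
move=> u v u' v' uW vW uW' vW' ch ch'.
have [p [l [l0 pl uvE ch1]]] := ordered u v uW vW ch.
have [p' [l' [l0' pl' uvE' ch1']]] := ordered u' v' uW' vW' ch'.
have [DA DAF [hDA sDA]] := inA u v p l l0 pl uvE ch1.
rewrite uvE uvE' => ne.
(* If the cycle through the first chord also contains the second, both have the same difference [l].
   A rotated line through the first chord then misses the second, and its cycle separates them. *)
have [inDA|notDA] := boolP ([set nth x0 w p'; nth x0 w (p' + l')] \in DA);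
  last by exists DA; rewrite ?inE ?DAF // -uvE.
have C' : [set nth x0 w p'; nth x0 w (p' + l')] \notin cycle_edges c.
  by case/andP: ch1'.
have lE : l' = l.
  move/subsetP/(_ _ inDA): sDA; rewrite inE (negPf C') inE => /mapP[a /KAP[h1 h2]].
  have h2' : a.2 < m by rewrite h2 addnC -ltn_subRL.
  have h1' : a.1 < m by apply: leq_ltn_trans h2'; rewrite h2 leq_addr.
  have pm' : p' < m := leq_ltn_trans (leq_addr _ _) pl'.
  case/(pairI _ _ _ _ pm' pl' h1' h2') => -[]; rewrite h2.
    by move=> -> /eqP; rewrite eqn_add2l => /eqP.
  by move: l0; clear; lia.
have [r [k [rm km kE]]] := on_rotated_line l0 pl.
have fm i : i < m -> shift m r i < m by apply: ltn_shift.
have nthf i : i < m -> nth x0 (rot r w) i = nth x0 w (shift m r i).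
  by move=> im; rewrite nth_rot_small szw.
have half i : i < m./2 -> i < m /\ i.*2.+1 < m by clear; lia.
have [km1 km2] := half k km.
have [_ subDB covDB] := hB (Ordinal rm).
have E : [set nth x0 w p; nth x0 w (p + l)] =
    [set nth x0 w (shift m r k); nth x0 w (shift m r k.*2.+1)].
  by case: kE => -[-> ->]; rewrite // setUC.
have [||DB DBF hDB] := covDB (k, k.*2.+1); rewrite ?[_.1]/= ?[_.2]/=.
- by apply/mapP; exists k; rewrite // mem_iota.
- rewrite !nthf //.
  by case: kE => -[-> ->]; rewrite // /chord e_sym setUC.
exists DB; first by rewrite inE; apply/orP; right; apply/bigcupP; exists (Ordinal rm).
split; first by move: hDB; rewrite [(_, _).1]/= [(_, _).2]/= !nthf // -E.
apply: contraNN ne => inDB; apply/eqP.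
have [_ /subsetP/(_ _ inDB)] := subDB _ DBF.
rewrite inE (negPf C') inE => /mapP[[k' k2'] /KBP[/= h1 ->]].
have [km1' km2'] := half k' h1.
rewrite !nthf // => E'; rewrite E' E.
suff -> : k' = k by [].
have pm' : p' < m by exact: leq_ltn_trans (leq_addr _ _) pl'.
apply: (rotated_line_inj km h1 rm kE (p' := p')); rewrite -lE.
by case: (pairI _ _ _ _ pm' pl' (fm _ km1') (fm _ km2') E') => -[-> ->]; auto.
Qed.

End Families.

(** * Posa rotations of a longest path *)

Section Rotation.
Variables (T : finType) (e : rel T).
Hypotheses (e_sym : symmetric e).
Implicit Types (x y z u v : T) (s a b : seq T).

Lemma adj_rev s x y : adj (rev s) x y -> adj s x y.
Proof.
move=> [s1 [s2 h]]; exists (rev s2), (rev s1).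
by case: h => /(congr1 rev); rewrite revK rev_cat !rev_cons -!cats1 -!catA; auto.
Qed.

Lemma adj_cat_inv a b x y : adj (a ++ b) x y ->
  [\/ adj a x y, adj b x y
    | exists a' b', (a = rcons a' x /\ b = y :: b') \/ (a = rcons a' y /\ b = x :: b')].
Proof.
have main x' y' s1 s2 : a ++ b = s1 ++ x' :: y' :: s2 ->
    [\/ adj a x' y', adj b x' y' | exists a' b', a = rcons a' x' /\ b = y' :: b'].
  elim: a s1 => [|u a' IH] s1 /=; first by move=> ->; constructor 2; exists s1, s2; left.
  case: s1 => [|w s1] /= [-> E].
    case: a' E {IH} => [|w a'] /= => [->|[-> _]]; first by constructor 3; exists [::], s2.
    by constructor 1; exists [::], a'; left.
  case: (IH s1 E) => [h|h|[a1 [b1 [-> ->]]]].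
  - by constructor 1; rewrite -cat1s; apply: adj_catl.
  - by constructor 2.
  - by constructor 3; exists (w :: a1), b1.
move=> [s1 [s2 [/main|/main]]] [h|h|[a' [b' h]]].
- by constructor 1.
- by constructor 2.
- by constructor 3; exists a', b'; left.
- by constructor 1; apply: adjC.
- by constructor 2; apply: adjC.
- by constructor 3; exists a', b'; right.
Qed.

(** Reversing the part before [y] trades the path edge entering [y] for the edge from [x] to [y]. *)
Lemma sorted_rotate x a y b : e x y -> sorted e (x :: a ++ y :: b) ->
  sorted e (rev (x :: a) ++ y :: b).
Proof.
move=> exy; rewrite -cat_cons.
have E p z q : sorted e (p ++ z :: q) = sorted e (rcons p z) && path e z q.
  by case: p => //= u p; rewrite cat_path rcons_path /= andbA.
rewrite E => /andP[+ pb]; rewrite -cats1 => /cat_sorted2[sa _].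
rewrite rev_cons cat_rcons E -rev_cons rev_sorted /= exy pb !andbT.
by rewrite (eq_path (e' := e)) // => u v; rewrite e_sym.
Qed.

Variables (n : nat) (t0 : n.-tuple T).

(* The rotating end of a path is its head. *)
Definition rotation : rel (n.-tuple T) := fun t t' =>
  [exists i : 'I_n, [&& 0 < i, e (nth (tnth t i) t 0) (tnth t i)
    & tval t' == rev (take i t) ++ drop i t]].

Lemma reach_step (t : n.-tuple T) x a y b : connect rotation t0 t ->
    tval t = x :: a ++ y :: b -> e x y ->
  exists2 t' : n.-tuple T, connect rotation t0 t' & tval t' = rev (x :: a) ++ y :: b.
Proof.
move=> ct tE exy.
have szt : size (rev (x :: a) ++ y :: b) == n.
  by rewrite -(size_tuple t) tE -cat_cons !size_cat size_rev.
exists (Tuple szt) => //; apply: connect_trans ct (connect1 _).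
have ia : (size a).+1 < n.
  by rewrite -(size_tuple t) tE /= size_cat /=; lia.
apply/existsP; exists (Ordinal ia); rewrite /= !(tnth_nth x) tE -cat_cons.
by rewrite /= nth_cat ltnn subnn /= exy take_size_cat // drop_size_cat // eqxx.
Qed.

Lemma reach_ind (Q : seq T -> Prop) : Q t0 ->
    (forall (t : n.-tuple T) x a y b, connect rotation t0 t ->
       tval t = x :: a ++ y :: b -> e x y -> Q t -> Q (rev (x :: a) ++ y :: b)) ->
  forall t : n.-tuple T, connect rotation t0 t -> Q t.
Proof.
move=> Q0 QS t /connectP[p pp ->]; elim/last_ind: p pp => // p t' IH.
rewrite rcons_path last_rcons => /andP[pp /existsP[i /and3P[i0 eh /eqP->]]].
set t1 := last t0 p in eh *.
have ct : connect rotation t0 t1 by apply/connectP; exists p.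
have it : i < size t1 by rewrite size_tuple.
move: eh; rewrite (tnth_nth (tnth t1 i)) => eh.
case ta : (take i t1) => [|x a].
  by move: (size_takel (ltnW it)); rewrite ta /= => i0'; move: i0; rewrite -i0'.
have E : tval t1 = x :: a ++ nth (tnth t1 i) t1 i :: drop i.+1 t1.
  by rewrite -drop_nth // -cat_cons -ta cat_take_drop.
rewrite (drop_nth (tnth t1 i)) //; apply: (QS t1) => //; last exact: IH.
by move: eh; rewrite {2}E.
Qed.

End Rotation.

(* The part of the path beyond the element [x] of [W] that is farthest from the
   rotating end never moves, so a neighbour of [x] that becomes the rotating end
   closes a cycle through [W]. *)
Lemma posa (T : finType) (e : rel T) (v0 : T) (V : {set T}) :
    symmetric e -> irreflexive e -> v0 \in V -> (forall u v, e u v -> v \in V) ->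
    (forall u v, v \in V -> exists2 w, w != u & e v w) ->
  exists (S W : {set T}) c, [/\ S != set0 /\ S \subset W,
    forall u v, u \in S -> e u v -> v \in W, #|W| <= 3 * #|S|
    & [/\ ucycle e c, 2 < size c & {subset W <= c}]].
Proof.
move=> e_sym e_irr v0V eV deg.
pose lp n := [exists t : n.-tuple T, [&& sorted e t, uniq t & all [in V] t]].
have lp1 : lp 1 by apply/existsP; exists [tuple v0]; rewrite /= v0V.
have lp_max n : lp n -> n <= #|T|.
  by move=> /existsP[t /and3P[_ Ut _]]; rewrite -(size_tuple t) -(card_uniqP Ut) max_card.
have [n /existsP[t0 /and3P[st0 Ut0 /allP Vt0]] maxn] := ex_maxnP (ex_intro _ 1 lp1) lp_max.
have n_gt0 : 0 < n by apply: maxn.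
pose reach := connect (rotation e (n := n)) t0.
have inv t : reach t -> perm_eq t t0 /\ sorted e t.
  apply: (reach_ind (Q := fun s => perm_eq s t0 /\ sorted e s)) => //.
  move=> {}t x a y b _ tE exy [pt st].
  split; last by apply: sorted_rotate; rewrite -?tE.
  by apply: perm_trans pt; rewrite tE -cat_cons perm_cat2r perm_rev.
(* By maximality: a neighbour of the rotating end off the path could be prepended. *)
have out t v q y : reach t -> tval t = v :: q -> e v y -> y \in tval t0.
  move=> /inv[pt st] tE evy; apply: contraT => yt.
  have : lp n.+1.
    apply/existsP; exists [tuple of y :: t]; rewrite /= (perm_mem pt) yt.
    rewrite (perm_uniq pt) Ut0 (eV _ _ evy) (perm_all _ pt) (introT allP Vt0).
    by rewrite tE /= e_sym evy -/(sorted e (v :: q)) -tE st.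
  by move=> /maxn; rewrite ltnn.
pose S := [set v | [exists t, reach t && (ohead t == Some v)]].
have SP v : reflect (exists t q, reach t /\ tval t = v :: q) (v \in S).
  rewrite inE; apply: (iffP existsP) => [[t /andP[rt]]|[t [q [rt tE]]]].
    by case E : (tval t) => [//|u q] /eqP[<-]; exists t, q.
  by exists t; rewrite rt tE /=.
pose W := S :|: [set y | [exists v in S, e v y]].
have SW : S \subset W by apply: subsetUl.
have NW u v : u \in S -> e u v -> v \in W.
  by move=> uS uv; rewrite !inE; apply/orP; right; apply/existsP; exists u; rewrite uS.
have W0 y : y \in W -> y \in tval t0.
  rewrite inE => /orP[/SP[t [q [rt tE]]]|].
    by have [pt _] := inv t rt; rewrite -(perm_mem pt) tE mem_head.
  by rewrite inE => /existsP[v /andP[/SP[t [q [rt tE]]] evy]]; apply: out tE evy.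
have headS t x a : reach t -> tval t = x :: a -> x \in S.
  by move=> rt tE; apply/SP; exists t, a.
have newS t x a y b : reach t -> tval t = x :: a ++ y :: b -> e x y -> last x a \in S.
  move=> rt tE exy; have [t' rt' tE'] := reach_step rt tE exy.
  move: tE'; rewrite lastI rev_rcons /= => tE'; exact: headS rt' tE'.
(* Neighbours on the initial path. The values at its two ends, [v0] and the head itself, do no harm,
   since [nx] and [pv] only bound [W] from above. *)
pose nx z := nth v0 t0 (index z t0).+1; pose pv z := nth v0 t0 (index z t0).-1.
have adjE z y : adj t0 z y -> y = nx z \/ y = pv z.
  rewrite /nx /pv => -[s1 [s2 [E|E]]]; move: Ut0; rewrite E cat_uniq => /and3P[_ h U2].
    have -> : index z (s1 ++ z :: y :: s2) = size s1.
      rewrite index_cat /= eqxx addn0; case: ifP => // zs1.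
      by case/negP: h; apply/hasP; exists z; rewrite ?mem_head.
    by left; rewrite nth_cat ltnNge leqnSn /= subSnn.
  have -> : index z (s1 ++ y :: z :: s2) = (size s1).+1.
    move: U2; rewrite /= inE => /and3P[/norP[yz _] _ _].
    rewrite index_cat /= eqxx (negPf yz) addn1; case: ifP => // zs1.
    by case/negP: h; apply/hasP; exists z; rewrite ?inE ?eqxx ?orbT.
  by right; rewrite nth_cat /= ltnn subnn.
(* A vertex [y] outside [S] with no neighbour on [t0] in [S] gains no path neighbour under
   rotations. But if a rotating end is adjacent to [y], rotating there puts the predecessor of [y]
   into [S], and this predecessor was adjacent to [y] on [t0] already. *)
have posaW y : y \in W -> y \in S :|: ((nx @: S) :|: (pv @: S)).
  move=> yW; apply: contraT; rewrite !(in_setU y) => /norP[yS /norP[ynx ypv]].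
  have noadj z : z \in S -> ~ adj t0 z y.
    move=> zS /adjE[yE|yE]; [case/negP: ynx|case/negP: ypv];
    by rewrite yE; apply: imset_f.
  have keep (t : n.-tuple T) : reach t -> forall z, adj t z y -> adj t0 z y.
    apply: (reach_ind (Q := fun s => forall z, adj s z y -> adj t0 z y)) => //.
    move=> {}t x a y' b rt tE exy IH z.
    have xy : y != x.
      by apply: contraNneq yS => ->; apply: headS rt tE.
    have yy' : y != y'.
      apply/eqP => yE; apply: (noadj _ (newS t x a y' b rt tE exy)).
      apply: IH; rewrite tE yE -cat_cons lastI -cats1 -catA; apply: adj_catl.
      by exists [::], b; left.
    move=> /adj_cat_inv[h|h|[a' [b' [[_ [bE _]]|[/(congr1 rev) aE _]]]]].
    - apply: IH; rewrite tE -cat_cons; apply: adj_catr; exact: adj_rev.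
    - by apply: IH; rewrite tE -cat_cons; apply: adj_catl.
    - by rewrite bE eqxx in yy'.
    - by move: aE; rewrite revK rev_rcons => -[xE _]; rewrite xE eqxx in xy.
  move: yW; rewrite in_setU (negPf yS) inE => /existsP[v /andP[/SP[t [q [rt tE]]] evy]].
  have yt : y \in tval t by rewrite (perm_mem (inv t rt).1); apply: out tE evy.
  move: yt; rewrite tE inE => /orP[/eqP yv|yq]; first by rewrite yv e_irr in evy.
  move/splitPr: yq tE => [a b] tE.
  have lS := newS t v a y b rt tE evy.
  case: (noadj _ lS); apply: (keep t rt); rewrite tE -cat_cons lastI -cats1 -catA.
  by apply: adj_catl; exists [::], b; left.
have [t0h [t0q t0E]] : exists x q, tval t0 = x :: q.
  have : size t0 = n by rewrite size_tuple.
  by case: (tval t0) => [|x q]; [move=> E; move: n_gt0; rewrite -E | exists x, q].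
have S0 : t0h \in S by apply: headS t0E; apply: connect0.
have W0' : t0h \in W by apply: subsetP SW _ S0.
case: (arg_maxnP (index^~ (tval t0)) W0') => x xW xmax.
have [a [b [tE xa]]] : exists a b, tval t0 = a ++ x :: b /\ x \notin a.
  have xt0 := W0 x xW.
  exists (take (index x t0) t0), (drop (index x t0).+1 t0); split.
    by rewrite -[x in x :: _](nth_index v0 xt0) -drop_nth ?index_mem // cat_take_drop.
  by rewrite in_take // ltnn.
have Wa y : y \in W -> y \in rcons a x.
  move=> yW; have := xmax y yW; have := W0 y yW.
  rewrite tE -cat_rcons mem_cat => /orP[//|yb].
  case: (boolP (y \in rcons a x)) => // ya.
  rewrite /= index_cat (negPf ya) index_cat mem_rcons mem_head size_rcons -cats1.
  rewrite index_cat (negPf xa) /= eqxx addn0; clear; lia.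
have suf (t : n.-tuple T) : reach t ->
    exists a', tval t = a' ++ x :: b /\ perm_eq a' a.
  apply: (reach_ind (Q := fun s => exists a', s = a' ++ x :: b /\ perm_eq a' a)).
    by exists a.
  move=> {}t u p y d rt tE' euy [a' [aE pa]].
  have yW : y \in W by apply: NW euy; apply: headS rt tE'.
  have yb : y \notin b.
    apply/negP => yb; have := Wa y yW; move: Ut0; rewrite tE -cat_rcons cat_uniq.
    by move=> /and3P[_ /hasPn/(_ y yb)/negP h _] /h.
  move: aE; rewrite tE' -cat_cons => aE.
  have [szle|szgt] := leqP (size (u :: p)) (size a').
    have a'E : a' = (u :: p) ++ drop (size (u :: p)) a'.
      have := congr1 (take (size (u :: p))) aE.
      rewrite take_size_cat // takel_cat // => hE.
      by rewrite {1}hE cat_take_drop.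
    have yE : y :: d = drop (size (u :: p)) a' ++ x :: b.
      have := congr1 (drop (size (u :: p))) aE.
      rewrite drop_size_cat // drop_cat; case: ltnP => // sz2 ->.
      have sE : size (u :: p) = size a' by apply/eqP; rewrite eqn_leq szle sz2.
      by rewrite sE subnn drop0 drop_size.
    exists (rev (u :: p) ++ drop (size (u :: p)) a'); rewrite -catA -yE; split=> //.
    by apply: perm_trans pa; rewrite [X in perm_eq _ X]a'E perm_cat2r perm_rev.
  have := congr1 (drop (size (u :: p))) aE.
  rewrite drop_size_cat // drop_cat ltnNge (ltnW szgt) /= => yE.
  case/negP: yb; have : 0 < size (u :: p) - size a' by rewrite subn_gt0.
  case: (size (u :: p) - size a') yE => // k /= yE _.
  by apply: (@mem_drop k); rewrite -yE mem_head.
have sufW a' y : perm_eq a' a -> y \in W -> y \in rcons a' x.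
  by move=> pa /Wa; rewrite !mem_rcons !inE (perm_mem pa).
(* Otherwise some reachable path is [x :: b], which leaves only [x] for [W], whereas [x] would have
   another neighbour in [W]. *)
have xS : x \notin S.
  apply/negP => /SP[t [q [rt tE']]]; have [a' [aE pa]] := suf t rt.
  have xa' : x \notin a' by rewrite (perm_mem pa).
  case: a' aE pa xa' => [|v a'] aE pa xa'; last first.
    by move: aE xa'; rewrite tE' => -[<- _]; rewrite mem_head.
  have [w wx xw] := deg x x (Vt0 _ (W0 x xW)).
  have : w \in W by apply: NW xw; apply: headS rt tE'.
  by move=> /(sufW _ _ pa); rewrite inE (negPf wx).
have [v vS vx] : exists2 v, v \in S & e v x.
  have : x \in W := xW.
  by rewrite in_setU (negPf xS) inE => /existsP[v /andP[vS vx]]; exists v.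
have /SP[t [q [rt tE']]] := vS; have [a' [aE pa]] := suf t rt.
case: a' aE pa => [|v' a'] aE pa.
  by move: aE; rewrite tE' => -[vE _]; rewrite vE e_irr in vx.
have vE : v' = v by move: aE; rewrite tE' => -[].
rewrite {v'}vE in aE pa.
have [pt st] := inv t rt.
exists S, W, (rcons (v :: a') x); split.
- by split=> //; apply/set0Pn; exists t0h.
- exact: NW.
- have sub : W \subset S :|: ((nx @: S) :|: (pv @: S)) by apply/subsetP.
  apply: leq_trans (subset_leq_card sub) _.
  rewrite (leq_trans (leq_card_setU _ _)) // mulSn leq_add2l.
  rewrite (leq_trans (leq_card_setU _ _)) // mulSn leq_add ?leq_imset_card //.
  by rewrite mul1n leq_imset_card.
- have Ut : uniq t by rewrite (perm_uniq pt).
  have Uc : uniq (rcons (v :: a') x).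
    by move: Ut; rewrite aE -cat_rcons cat_uniq => /andP[].
  split; last by move=> y /(sufW _ _ pa).
    rewrite /ucycle Uc andbT rcons_cons /= rcons_path last_rcons e_sym vx andbT.
    by move: st; rewrite aE -cat_rcons rcons_cons /= cat_path => /andP[].
  (* A neighbour of [v] other than [x] lies in [W], hence on the cycle, and provides a third
     vertex. *)
  have [w wx vw] := deg x v (Vt0 _ (W0 v (subsetP SW _ vS))).
  have wW := NW v w vS vw.
  have U3 : uniq [:: v; w; x].
    rewrite /= !inE negb_or wx !andbT; apply/andP; split; apply/eqP => E.
      by rewrite -E e_irr in vw.
    by rewrite -E e_irr in vx.
  apply: (uniq_leq_size U3) => y; rewrite !inE => /or3P[] /eqP->.
  - by rewrite ?mem_rcons !inE eqxx ?orbT.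
  - exact: sufW pa wW.
  - by rewrite ?mem_rcons !inE eqxx ?orbT.
Qed.

(** * Covering and separating systems by deleting vertices *)

Section Systems.
Variable T : finType.
Implicit Types (e : rel T) (S V W : {set T}) (H : {set {set T}}) (a b : {set T}).
Implicit Types (F FS : {set {set {set T}}}).

Definition piece e H : Prop := is_edge e H \/ is_cycle e H.

Lemma edgesP e (z : {set T}) :
  reflect (exists u v, e u v /\ z = [set u; v]) (z \in edges e).
Proof.
apply: (iffP imset2P) => [[u v _ uv ->]|[u [v [uv ->]]]]; first by exists u, v.
by exists u v.
Qed.

Lemma edges_set2 e u v : symmetric e -> ([set u; v] \in edges e) = e u v.
Proof.
move=> e_sym; apply/edgesP/idP => [[x [y [xy]]]|uv]; last by exists u, v.
by case/set2_eq=> -[-> ->] //; rewrite e_sym.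
Qed.

Lemma piece_sub_edges e H : piece e H -> H \subset edges e.
Proof.
case=> [[z ze ->]|[p [_ /andP[Cp _] ->]]]; first by rewrite sub1set.
apply/subsetP => z /(cycle_edgesP Cp)[u [v [_ _ uv ->]]].
by apply/edgesP; exists u, v.
Qed.

Lemma sub_piece e e' H : subrel e' e -> piece e' H -> piece e H.
Proof.
move=> see [[z /edgesP[u [v [uv ->]]] ->]|[p [szp /andP[Cp Up] ->]]]; [left|right].
  by exists [set u; v] => //; apply/edgesP; exists u, v; split=> //; apply: see.
by exists p; split=> //; rewrite /ucycle Up (sub_cycle see Cp).
Qed.

(** Deleted vertices stay in [T] as isolated ones; the inductions measure the graph by a set [V]
    containing the ends of all edges. *)
Definition delete e S : rel T := fun u v => [&& e u v, u \notin S & v \notin S].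

Lemma delete_sym e S : symmetric e -> symmetric (delete e S).
Proof. by move=> e_sym u v; rewrite /delete e_sym andbA andbAC -andbA. Qed.

Lemma delete_irr e S : irreflexive e -> irreflexive (delete e S).
Proof. by move=> e_irr u; rewrite /delete e_irr. Qed.

Definition singles (A : {set {set T}}) : {set {set {set T}}} :=
  [set [set z] | z in A].

Lemma singles_piece e (A : {set {set T}}) H : A \subset edges e -> H \in singles A -> piece e H.
Proof. by move=> /subsetP sA /imsetP[z /sA ze ->]; left; exists z. Qed.

Definition star e v : {set {set T}} := [set z in edges e | v \in z].

Lemma card_singles_star e u v : symmetric e -> irreflexive e ->
  (forall w, e v w -> w = u) -> #|singles (star e v)| <= 1.
Proof.
move=> e_sym e_irr vu; rewrite card_imset; last exact: set1_inj.
rewrite -(cards1 [set v; u]); apply/subset_leq_card/subsetP => z.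
rewrite !inE => /andP[/edgesP[x [y [xy ->]]]]; rewrite !inE.
case/orP=> /eqP E; move: xy; rewrite -?E => /[dup] xy.
  by move/vu->.
by rewrite e_sym => /vu->; rewrite setUC.
Qed.

Lemma cardsU_leq (U : finType) (A B : {set U}) : #|A :|: B| <= #|A| + #|B|.
Proof. by rewrite cardsU leq_subr. Qed.

Definition covers F e := forall u v, e u v -> exists2 H, H \in F & [set u; v] \in H.

(** Either some vertex of [V] has degree at most one, any [u] serving for an isolated vertex, or all
    have degree at least two. *)
Lemma leaf_or_branching e V :
  (exists v u, v \in V /\ forall w, e v w -> w = u) \/
  (forall u v, v \in V -> exists2 w, w != u & e v w).
Proof.
have [/existsP[v /andP[vV /existsP[u /forallP vu]]]|no] :=
    boolP [exists v in V, exists u, forall w, e v w ==> (w == u)].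
  by left; exists v, u; split=> // w; have /implyP h := vu w; move/h/eqP.
right=> u v vV; move: no; rewrite negb_exists => /forallP/(_ v).
rewrite vV /= negb_exists => /forallP/(_ u); rewrite negb_forall => /existsP[w].
by rewrite negb_imply => /andP[vw wu]; exists w.
Qed.

Lemma cover_step e S F FS : symmetric e ->
    (forall H, H \in F -> piece (delete e S) H) -> covers F (delete e S) ->
    (forall H, H \in FS -> piece e H) ->
    (forall u v, u \in S -> e u v -> exists2 H, H \in FS & [set u; v] \in H) ->
  (forall H, H \in F :|: FS -> piece e H) /\ covers (F :|: FS) e.
Proof.
move=> e_sym pF cF pFS cFS; split.
  move=> H; rewrite inE => /orP[/pF|/pFS //].
  by apply: sub_piece => u v /andP[].
have touch u v : u \in S -> e u v ->
    exists2 H, H \in F :|: FS & [set u; v] \in H.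
  by move=> uS uv; have [H HF uvH] := cFS u v uS uv; exists H; rewrite // inE HF orbT.
move=> u v uv; have [/touch/(_ uv) //|uS] := boolP (u \in S).
have [vS|vS] := boolP (v \in S); first by rewrite [[set u; v]]setUC; apply: touch; rewrite // e_sym.
have [|H HF uvH] := cF u v; first by rewrite /delete uv uS.
by exists H; rewrite // inE HF.
Qed.

Lemma leaf_step e u v : symmetric e -> irreflexive e ->
    (forall w, e v w -> w = u) ->
  [/\ forall H, H \in singles (star e v) -> piece e H,
      forall x y, x \in [set v] -> e x y -> [set [set x; y]] \in singles (star e v)
    & #|singles (star e v)| <= 1].
Proof.
move=> e_sym e_irr vu; split; last exact: card_singles_star vu.
  by move=> H; apply: singles_piece; apply/subsetP => z; rewrite inE => /andP[].
move=> x y /set1P-> vy; apply: imset_f.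
by rewrite inE edges_set2 // vy set21.
Qed.

Lemma delete_sub e S V : (forall u v, e u v -> v \in V) ->
  forall u v, delete e S u v -> v \in V :\: S.
Proof. by move=> eV u v /and3P[/eV vV _ vS]; rewrite inE vS. Qed.

Lemma cardsD_sub S V : S \subset V -> #|V :\: S| + #|S| = #|V|.
Proof. by move=> SV; rewrite cardsDS // subnK // subset_leq_card. Qed.

Lemma sub_cycle_verts e V S W c : (forall u v, e u v -> v \in V) ->
  ucycle e c -> {subset W <= c} -> S \subset W -> S \subset V.
Proof.
move=> eV /andP[Cc _] Wc /subsetP SW; apply/subsetP => x /SW/Wc xc.
exact: eV (prev_cycle Cc xc).
Qed.

(** Induction on [V]: a vertex of degree at most one costs at most one edge; otherwise [posa]
    applies, and [c] with the family [FA] covers all edges at [S]. Sizes are doubled to avoid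
    halves. *)
Lemma cycle_cover e V : symmetric e -> irreflexive e ->
    (forall u v, e u v -> v \in V) ->
  exists F, [/\ forall H, H \in F -> piece e H, covers F e & 2 * #|F| <= 15 * #|V|].
Proof.
have [n] := ubnP #|V|; elim: n e V => // n IH e V ltVn e_sym e_irr eV.
have rec S : S != set0 -> S \subset V -> exists F,
    [/\ forall H, H \in F -> piece (delete e S) H, covers F (delete e S)
      & 2 * #|F| + 15 * #|S| <= 15 * #|V|].
  rewrite -card_gt0 => S0 SV; have := cardsD_sub SV => cVS.
  have [||||F [pF cF szF]] := IH (delete e S) (V :\: S).
  - by move: ltVn S0; rewrite -cVS; clear; lia.
  - exact: delete_sym.
  - exact: delete_irr.
  - exact: delete_sub.
  - by exists F; split=> //; rewrite -cVS; move: szF; clear; lia.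
have [[v [u [vV vu]]]|deg] := leaf_or_branching e V.
  have v0 : [set v] != set0 by apply/set0Pn; exists v; rewrite set11.
  have vV1 : [set v] \subset V by rewrite sub1set.
  have [F [pF cF szF]] := rec _ v0 vV1.
  have [pS cS szS] := leaf_step e_sym e_irr vu.
  have [|p c] := @cover_step e [set v] F _ e_sym pF cF pS.
    by move=> x y xS xy; exists [set [set x; y]]; rewrite ?set11 ?cS.
  exists (F :|: singles (star e v)); split=> //.
  have := cardsU_leq F (singles (star e v)); move: szF szS; rewrite cards1.
  by clear; move=> /= h1 h2 h3; lia.
have [V0|[v0 v0V]] := set_0Vmem V.
  exists set0; split; [by move=> H; rewrite inE | | by rewrite cards0].
  by move=> u v /eV; rewrite V0 inE.
have [S [W [c [[S0 SW] NW szW [Cc szc Wc]]]]] := posa e_sym e_irr v0V eV deg.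
have SV := sub_cycle_verts eV Cc Wc SW.
have [F [pF cF szF]] := rec S S0 SV.
have [FA [FB [[szA _] cyc cA _]]] := chord_families e_sym e_irr Cc szc Wc.
have [||p cv] := @cover_step e S F (cycle_edges c |: FA) e_sym pF cF.
- move=> H; rewrite !inE => /orP[/eqP->|HA]; right; first by exists c.
  by apply: cyc; rewrite inE HA.
- move=> u v uS uv; have [uvC|uvC] := boolP ([set u; v] \in cycle_edges c).
    by exists (cycle_edges c); rewrite // !inE eqxx.
  have [|||D DA uvD] := cA u v _ _ _.
  + exact: subsetP SW _ uS.
  + exact: NW uS uv.
  + by rewrite /chord uv uvC.
  + by exists D; rewrite // inE DA orbT.
exists (F :|: (cycle_edges c |: FA)); split=> //.
have W0 : 0 < #|W| by apply: leq_trans (subset_leq_card SW); rewrite card_gt0.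
(* The cycle [c] is paid for by the [w.-1], in place of [w], in the bound on [FA]. *)
have bound f s v i w x y : 2 * f + 15 * s <= 15 * v -> 2 * i <= 5 * w.-1 ->
    w <= 3 * s -> 0 < w -> x <= 1 + i -> y <= f + x -> 2 * y <= 15 * v.
  by clear; lia.
apply: (bound _ _ _ _ _ _ _ szF szA szW W0 _ (cardsU_leq _ _)).
by rewrite -(cards1 (cycle_edges c)) cardsU_leq.
Qed.

(** A vertex of [S] lies only on the cycle edges to its successor and from its predecessor. *)
Lemma card_cycle_edges_at c S : uniq c ->
  #|[set z in cycle_edges c | ~~ [disjoint z & S]]| <= 2 * #|S|.
Proof.
move=> Uc; rewrite mul2n -addnn.
pose A := [set [set x; next c x] | x in S] :|: [set [set prev c x; x] | x in S].
apply: leq_trans (_ : #|A| <= _); last first.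
  by apply: leq_trans (cardsU_leq _ _) _; rewrite leq_add ?leq_imset_card.
apply/subset_leq_card/subsetP => z; rewrite inE => /andP[].
rewrite inE => /mapP[x xc ->] /pred0Pn[y /andP[]] /=; rewrite !inE.
move=> /orP[]/eqP-> yS; apply/orP; [left|right]; apply/imsetP.
  by exists x.
by exists (next c x); rewrite // prev_next.
Qed.

Lemma separates_sub F F' a b : F \subset F' -> separates F a b -> separates F' a b.
Proof. by move=> /subsetP sF [H HF h]; exists H => //; apply: sF. Qed.

(** An edge avoiding [S] is separated from an edge at [S] by any member of [F] that covers it, since
    the members of [F] live in the graph without [S]. *)
Lemma separate_step e S F FS : symmetric e ->
    (forall H, H \in F -> piece (delete e S) H) -> covers F (delete e S) ->
    (forall a b, a \in edges (delete e S) -> b \in edges (delete e S) ->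
       a != b -> separates F a b) ->
    (forall u v b, u \in S -> e u v -> b \in edges e -> [set u; v] != b ->
       separates FS [set u; v] b) ->
  forall a b, a \in edges e -> b \in edges e -> a != b -> separates (F :|: FS) a b.
Proof.
move=> e_sym pF cF sF sFS a b /edgesP[u [v [uv ->]]] be ab.
have [uS|uS] := boolP (u \in S).
  by apply: separates_sub (subsetUr _ _) _; apply: sFS.
have [vS|vS] := boolP (v \in S).
  apply: separates_sub (subsetUr _ _) _; rewrite [[set u; v]]setUC.
  by apply: sFS; rewrite // 1?e_sym // [[set v; u]]setUC.
apply: separates_sub (subsetUl _ _) _.
have uv' : delete e S u v by rewrite /delete uv uS.
have ae : [set u; v] \in edges (delete e S) by apply/edgesP; exists u, v.
have [be'|be'] := boolP (b \in edges (delete e S)); first exact: sF.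
have [H HF uvH] := cF u v uv'; exists H => //; split=> //.
by apply: contra be'; apply/subsetP/piece_sub_edges/pF.
Qed.

(** Covering is part of the induction because [separate_step] relies on it, and separation does not
    imply it for a graph with a single edge. *)
Lemma separating_system e V : symmetric e -> irreflexive e ->
    (forall u v, e u v -> v \in V) ->
  exists F, [/\ forall H, H \in F -> piece e H, covers F e,
    forall a b, a \in edges e -> b \in edges e -> a != b -> separates F a b
    & #|F| <= 41 * #|V|].
Proof.
have [n] := ubnP #|V|; elim: n e V => // n IH e V ltVn e_sym e_irr eV.
have rec S FS : S != set0 -> S \subset V -> #|FS| <= 41 * #|S| ->
    (forall H, H \in FS -> piece e H) ->
    (forall u v, u \in S -> e u v -> exists2 H, H \in FS & [set u; v] \in H) ->
    (forall u v b, u \in S -> e u v -> b \in edges e -> [set u; v] != b ->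
       separates FS [set u; v] b) ->
    exists F, [/\ forall H, H \in F -> piece e H, covers F e,
      forall a b, a \in edges e -> b \in edges e -> a != b -> separates F a b
      & #|F| <= 41 * #|V|].
  rewrite -card_gt0 => S0 SV szS pS cS sS; have := cardsD_sub SV => cVS.
  have [||||F [pF cF sF szF]] := IH (delete e S) (V :\: S).
  - by move: ltVn S0; rewrite -cVS; clear; lia.
  - exact: delete_sym.
  - exact: delete_irr.
  - exact: delete_sub.
  have [p c] := cover_step e_sym pF cF pS cS.
  exists (F :|: FS); split=> //; first exact: (separate_step (S := S)).
  rewrite -cVS mulnDr; apply: leq_trans (cardsU_leq _ _) _.
  exact: leq_add szF szS.
have [[v [u [vV vu]]]|deg] := leaf_or_branching e V.
  have [pS cS szS] := leaf_step e_sym e_irr vu.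
  apply: (rec [set v] (singles (star e v))); rewrite ?sub1set ?cards1 //.
  - by apply/set0Pn; exists v; rewrite set11.
  - by apply: leq_trans szS _.
  - by move=> x y xS xy; exists [set [set x; y]]; rewrite ?set11 ?cS.
  - move=> x y b xS xy _ ne; exists [set [set x; y]]; first exact: cS.
    by rewrite !inE eqxx eq_sym.
have [V0|[v0 v0V]] := set_0Vmem V.
  exists set0; split; [by move=> H; rewrite inE | | | by rewrite cards0].
    by move=> u v /eV; rewrite V0 inE.
  by move=> a b /edgesP[u [v [/eV]]]; rewrite V0 inE.
have [S [W [c [[S0 SW] NW szW [Cc szc Wc]]]]] := posa e_sym e_irr v0V eV deg.
have SV := sub_cycle_verts eV Cc Wc SW.
have [FA [FB [[szA szB] cyc _ sAB]]] := chord_families e_sym e_irr Cc szc Wc.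
have /andP[Cc' Uc] := Cc.
(* The edges at [S] outside [c] have both ends in [W], so covering them costs at most [15 / 2] per
   element of [W]. *)
pose eB : rel T := fun u v =>
  [&& e u v, (u \in S) || (v \in S) & [set u; v] \notin cycle_edges c].
have eB_sym : symmetric eB by move=> u v; rewrite /eB e_sym orbC setUC.
have eB_irr : irreflexive eB by move=> u; rewrite /eB e_irr.
have eBW u v : eB u v -> v \in W.
  by move=> /and3P[uv /orP[uS|/(subsetP SW)//] _]; apply: NW uS uv.
have [FC [pC cC szC]] := cycle_cover eB_sym eB_irr eBW.
pose X := [set z in cycle_edges c | ~~ [disjoint z & S]].
have XE u v : u \in S -> [set u; v] \in cycle_edges c -> [set u; v] \in X.
  move=> uS uvC; rewrite inE uvC; apply/pred0Pn; exists u.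
  by rewrite /= set21.
have sep u v b : u \in S -> e u v -> b \in edges e -> [set u; v] != b ->
    separates (singles X :|: FC :|: (FA :|: FB)) [set u; v] b.
  move=> uS uv /edgesP[x [y [xy ->]]] ne.
  have [uvC|uvC] := boolP ([set u; v] \in cycle_edges c).
    exists [set [set u; v]]; last by rewrite !inE eqxx eq_sym.
    by rewrite !in_setU imset_f // XE.
  have uvB : eB u v by rewrite /eB uv uS uvC.
  (* An edge outside [eB] belongs to no piece of the cover [FC]; two edges of [eB] are chords
     between marks and are left to [FA] and [FB]. *)
  have [xyB|xyB] := boolP (eB x y); last first.
    have [H HC uvH] := cC u v uvB; exists H; first by rewrite !in_setU HC orbT.
    split=> //; apply: contra xyB => xyH; rewrite -(edges_set2 _ _ eB_sym).
    exact: subsetP (piece_sub_edges (pC H HC)) _ xyH.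
  have vB : eB v u by rewrite eB_sym.
  have yB : eB y x by rewrite eB_sym.
  have [||H HAB sH] :=
    sAB u v x y (eBW _ _ vB) (eBW _ _ uvB) (eBW _ _ yB) (eBW _ _ xyB) _ _ ne.
  - by rewrite /chord uv uvC.
  - by rewrite /chord xy; case/and3P: xyB.
  by exists H; rewrite // in_setU HAB orbT.
apply: (rec S (singles X :|: FC :|: (FA :|: FB))) => //.
(* The halves add up to [15 / 2 + 5 / 2 + 3 = 13] per element of [W], and [13 * 3 + 2 = 41] per
   element of [S]. *)
- have bound x fc i j w s p q r : x <= 2 * s -> 2 * fc <= 15 * w ->
      2 * i <= 5 * w.-1 -> j <= 3 * w -> w <= 3 * s -> p <= x + fc -> q <= i + j ->
      r <= p + q -> r <= 41 * s.
    by clear; lia.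
  have h4 : #|singles X| <= 2 * #|S|.
    by apply: leq_trans (leq_imset_card _ _) _; apply: card_cycle_edges_at.
  exact: bound h4 szC szA szB szW (cardsU_leq _ _) (cardsU_leq _ _) (cardsU_leq _ _).
- move=> H; rewrite !(in_setU H) => /orP[/orP[|/pC]|HAB].
  + apply: singles_piece; apply/subsetP => z; rewrite inE => /andP[zC _].
    by have [x [y [_ _ xy ->]]] := cycle_edgesP Cc' zC; rewrite edges_set2.
  + by apply: sub_piece => u v /and3P[].
  + by right; apply: cyc; rewrite in_setU.
- move=> u v uS uv; have [uvC|uvC] := boolP ([set u; v] \in cycle_edges c).
    exists [set [set u; v]]; last by rewrite set11.
    by rewrite !in_setU imset_f // XE.
  have [|H HC uvH] := cC u v; first by rewrite /eB uv uS uvC.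
  by exists H; rewrite // !in_setU HC orbT.
Qed.

End Systems.

Theorem theorem2 (n : nat) (T : finType) (e : rel T)
    (e_sym : symmetric e) (e_irr : irreflexive e) (card_T : #|T| = n) :
  exists S : {set {set {set T}}},
    separating_cycle_system e S /\ #|S| <= 41 * n.
Proof.
have [|F [pF _ sF szF]] := @separating_system T e setT e_sym e_irr.
  by move=> u v _; rewrite inE.
by exists F; split; last by rewrite -card_T -cardsT.
Qed.
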